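(* Let $V$ be an $n$-dimensional Euclidean vector space, $G\subset SO(V)$ a closed connected subgroup acting transitively on the unit sphere, and $r_1,r_2\ge0$ integers. Let $\Phi_1,\dots,\Phi_{m_1}$ be a basis of $\mathrm{Val}^{r_1,G}$ and $\Psi_1,\dots,\Psi_{m_2}$ a basis of $\mathrm{Val}^{r_2,G}$. If $\Phi\in\mathrm{Val}^{r_1+r_2,G}$, then there exist constants $c_{ij}$ depending only on $\Phi$ such that $$\int_G(\mathrm{id}^{\otimes r_1}\otimes g^{\otimes r_2})\,\Phi(K+g^{-1}L)\,dg=\sum_{i,j}c_{ij}\,\Phi_i(K)\otimes\Psi_j(L)$$ for all convex bodies $K,L\subset V$. In particular, the additive kinematic operator can be regarded as a linear map $a^{r_1,r_2}:\mathrm{Val}^{r_1+r_2,G}\to\mathrm{Val}^{r_1,G}\otimes\mathrm{Val}^{r_2,G}$.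
   Context: $dg$ is Haar probability measure on $G$. $\mathrm{Sym}^rV\subset V^{\otimes r}$ is the space of symmetric tensors; $G$ acts on it by $g^{\otimes r}$. $\mathrm{Val}^r$ is the space of translation-invariant, continuous maps $\Phi$ from convex bodies in $V$ to $\mathrm{Sym}^rV$ with $\Phi(K\cup L)=\Phi(K)+\Phi(L)-\Phi(K\cap L)$ whenever $K\cup L$ is convex; $\mathrm{Val}^{r,G}$ is the subspace of those with $g^{\otimes r}(\Phi(g^{-1}K))=\Phi(K)$ for all $g\in G$. Note $(\mathrm{id}^{\otimes r_1}\otimes g^{\otimes r_2})$ maps $\mathrm{Sym}^{r_1+r_2}V$ into $\mathrm{Sym}^{r_1}V\otimes\mathrm{Sym}^{r_2}V$. The additive kinematic operator is $a^{r_1,r_2}(\Phi)(K,L)=\int_G(\mathrm{id}^{\otimes r_1}\otimes g^{\otimes r_2})\Phi(K+g^{-1}L)\,dg$. *)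

(* Defs.v *)
From HB Require Import structures.
From mathcomp Require Import all_boot all_order all_algebra all_fingroup.
From mathcomp Require Import all_classical all_reals all_analysis.
Set Implicit Arguments. Unset Strict Implicit. Unset Printing Implicit Defensive.
Import Order.TTheory GRing.Theory Num.Theory numFieldNormedType.Exports.
Local Open Scope ring_scope.
Local Open Scope classical_set_scope.

Section Defs.
Variables (R : realType) (n : nat).

Definition vec := 'cV[R]_n.
Definition mat := 'M[R]_(n, n).

Definition enorm (x : vec) : R := Num.sqrt (\sum_(i < n) x i 0 ^+ 2).
Definition unit_sphere : set vec := [set x | \sum_(i < n) x i 0 ^+ 2 = 1].

Definition convex_set (K : set vec) : Prop :=
  forall x y (t : R), K x -> K y -> 0 <= t <= 1 -> K (t *: x + (1 - t) *: y).
Definition convex_body (K : set vec) : Prop :=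
  K !=set0 /\ compact K /\ convex_set K.

Definition msum (K L : set vec) : set vec :=
  [set z | exists x y, K x /\ L y /\ z = x + y].
Definition translate (K : set vec) (x : vec) : set vec := [set y + x | y in K].
Definition mat_img (g : mat) (K : set vec) : set vec := [set g *m y | y in K].

Definition hausdorff_le (K L : set vec) (e : R) : Prop :=
  (forall x, K x -> exists y, L y /\ enorm (x - y) <= e) /\
  (forall y, L y -> exists x, K x /\ enorm (x - y) <= e).
Definition hausdorff_cvg (Ks : nat -> set vec) (K : set vec) : Prop :=
  forall e : R, 0 < e -> \forall k \near \oo, hausdorff_le (Ks k) K e.

(* V^{(x) r}, with coordinates indexed by r-tuples of basis indices. *)
Definition tens (r : nat) := {ffun r.-tuple 'I_n -> R}.

Definition permute_tuple (r : nat) (s : 'S_r) (i : r.-tuple 'I_n) : r.-tuple 'I_n :=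
  [tuple tnth i (s k) | k < r].
Definition symmetric_tensor (r : nat) (T : tens r) : Prop :=
  forall (s : 'S_r) (i : r.-tuple 'I_n), T (permute_tuple s i) = T i.

(* M_0 (x) ... (x) M_{r-1} acting on V^{(x) r}. *)
Definition tens_op (r : nat) (M : 'I_r -> mat) (T : tens r) : tens r :=
  [ffun i => \sum_(j : r.-tuple 'I_n)
                (\prod_(k < r) M k (tnth i k) (tnth j k)) * T j].
Definition tpow (r : nat) (g : mat) : tens r -> tens r := tens_op (fun _ => g).
Definition id_tpow (r1 r2 : nat) (g : mat) : tens (r1 + r2) -> tens (r1 + r2) :=
  tens_op (fun k : 'I_(r1 + r2) => if (k < r1)%N then 1%:M else g).

Definition tprod (r1 r2 : nat) (A : tens r1) (B : tens r2) : tens (r1 + r2) :=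
  [ffun i : (r1 + r2).-tuple 'I_n =>
     A [tuple tnth i (lshift r2 k) | k < r1] * B [tuple tnth i (rshift r1 k) | k < r2]].

(* Val^r : translation-invariant, continuous, Sym^r V-valued valuations
   on convex bodies (maps are total on sets; only values on convex
   bodies matter). *)
Definition is_tensor_valuation (r : nat) (Phi : set vec -> tens r) : Prop :=
  [/\ (forall K, convex_body K -> symmetric_tensor (Phi K)),
      (forall K x, convex_body K -> Phi (translate K x) = Phi K),
      (forall Ks K, (forall k, convex_body (Ks k)) -> convex_body K ->
          hausdorff_cvg Ks K ->
          forall i, (fun k => Phi (Ks k) i) @ \oo --> Phi K i) &
      (forall K L, convex_body K -> convex_body L -> convex_body (K `|` L) ->
          Phi (K `|` L) = Phi K + Phi L - Phi (K `&` L))].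

Definition is_G_valuation (G : set mat) (r : nat) (Phi : set vec -> tens r) : Prop :=
  is_tensor_valuation Phi /\
  forall g K, G g -> convex_body K -> tpow g (Phi (mat_img (invmx g) K)) = Phi K.

Definition is_basis_Val (G : set mat) (r m : nat) (Phis : 'I_m -> set vec -> tens r) : Prop :=
  [/\ (forall i, is_G_valuation G (Phis i)),
      (forall a : 'I_m -> R,
          (forall K, convex_body K -> \sum_(i < m) a i *: Phis i K = 0) ->
          forall i, a i = 0) &
      (forall Phi, is_G_valuation G Phi ->
          exists a : 'I_m -> R, forall K, convex_body K ->
            Phi K = \sum_(i < m) a i *: Phis i K)].

Definition SO_mem (g : mat) : Prop := g^T *m g = 1%:M /\ \det g = 1.
Definition closed_conn_subgroup_SO (G : set mat) : Prop :=
  [/\ G 1%:M, (forall g h, G g -> G h -> G (g *m h)),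
      (forall g, G g -> G (invmx g)), (forall g, G g -> SO_mem g) &
      closed G /\ connected G].
Definition transitive_on_sphere (G : set mat) : Prop :=
  forall x y, unit_sphere x -> unit_sphere y -> exists2 g, G g & g *m x = y.

Definition matB := g_sigma_algebraType (fun A : set mat => open A).

Definition haar_prob (G : set mat) (mu : probability matB R) : Prop :=
  mu (G : set matB) = 1%:E /\
  forall (g : mat) (A : set matB), G g -> measurable A ->
    mu [set h : matB | A (g *m (h : mat) : matB)] = mu A.

Definition add_kin (G : set mat) (mu : probability matB R) (r1 r2 : nat)
  (Phi : set vec -> tens (r1 + r2)) (K L : set vec) : tens (r1 + r2) :=
  [ffun i => Rintegral mu (G : set matB)
     (fun h : matB => @id_tpow r1 r2 (h : mat) (Phi (msum K (mat_img (invmx (h : mat)) L))) i)].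

End Defs.

(* Main.v *)
(* F(K, L), the kinematic integral, is a G-valuation in each variable
   separately: in L by left invariance of the Haar measure, in K by right
   invariance. Fixing K, the r2-slices of F(K, .) are therefore combinations of
   the Psi_j; evaluating at m2 pairs (body L_c, index) at which the values of
   the Psi_j form an invertible matrix recovers the coefficients as combinations of
   values F(., L_c), which lie in the span of the Phi_i.

   Right invariance follows from left invariance without Fubini: by compactness
   of G, the integral of f is a limit of sums of right translates of f, uniform
   on G, and integrating such sums against x^-1 shows invariance under inversion. *)
Require Import Defs.
From HB Require Import structures.
From mathcomp Require Import all_boot all_order all_algebra all_fingroup.
From mathcomp Require Import all_classical all_reals all_analysis.
From mathcomp Require Import measurable_realfun.
Set Implicit Arguments. Unset Strict Implicit. Unset Printing Implicit Defensive.
Import Order.TTheory GRing.Theory Num.Theory numFieldNormedType.Exports.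
Local Open Scope ring_scope.
Local Open Scope classical_set_scope.

(* The libraries define other notions under these two names. *)
Local Notation msum := Defs.msum.
Local Notation convex_set := Defs.convex_set.

(** * Operators on tensor powers, slices of tensors and their symmetry *)

Section Tensors.
Context {R : realType} {n : nat}.
Implicit Types (r : nat).

(** Distributing the product of the entrywise sums gives a sum over finite functions, which are
    reindexed as the tuples serving as intermediate multi-indices. *)
Lemma tens_op_comp r (M N : 'I_r -> mat R n) (T : tens R n r) :
  tens_op M (tens_op N T) = tens_op (fun k => M k *m N k) T.
Proof.
apply/ffunP => i; rewrite !ffunE.
under eq_bigr do rewrite ffunE big_distrr /=.
rewrite exchange_big /=; apply: eq_bigr => l _.
under eq_bigr do rewrite mulrA.
rewrite -big_distrl /=; congr (_ * _).
under [RHS]eq_bigr do rewrite mxE.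
rewrite bigA_distr_bigA /=.
rewrite (reindex (fun f : {ffun 'I_r -> 'I_n} => [tuple f k | k < r])) /=.
  apply: eq_bigr => f _; rewrite -big_split /=.
  by apply: eq_bigr => k _; rewrite tnth_mktuple.
exists (fun t : r.-tuple 'I_n => [ffun k => tnth t k]) => [f _|t _].
  by apply/ffunP => k; rewrite ffunE tnth_mktuple.
by apply: eq_from_tnth => k; rewrite tnth_mktuple ffunE.
Qed.

Lemma eq_tens_op r (M N : 'I_r -> mat R n) (T : tens R n r) :
  M =1 N -> tens_op M T = tens_op N T.
Proof.
move=> MN; apply/ffunP => i; rewrite !ffunE; apply: eq_bigr => j _.
by under eq_bigr do rewrite MN.
Qed.

Lemma tens_opD r (M : 'I_r -> mat R n) (S T : tens R n r) :
  tens_op M (S + T) = tens_op M S + tens_op M T.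
Proof.
apply/ffunP => i; rewrite !ffunE -big_split /=; apply: eq_bigr => j _.
by rewrite ffunE mulrDr.
Qed.

Lemma tens_opN r (M : 'I_r -> mat R n) (T : tens R n r) :
  tens_op M (- T) = - tens_op M T.
Proof.
apply/ffunP => i; rewrite !ffunE -sumrN; apply: eq_bigr => j _.
by rewrite ffunE mulrN.
Qed.

Lemma tens_op_permute r (M : 'I_r -> mat R n) (T : tens R n r) (s : 'S_r) i :
  (forall k, M (s k) = M k) -> symmetric_tensor T ->
  tens_op M T (permute_tuple s i) = tens_op M T i.
Proof.
move=> Ms Tsym; rewrite !ffunE.
rewrite (reindex (permute_tuple s)) /=.
  apply: eq_bigr => j _; rewrite Tsym; congr (_ * _).
  rewrite [RHS](reindex_inj (@perm_inj _ s)); apply: eq_bigr => k _.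
  by rewrite !tnth_mktuple Ms.
exists (permute_tuple s^-1) => j _; apply: eq_from_tnth => k;
  by rewrite !tnth_mktuple ?permK ?permKV.
Qed.

(** The operator $A^{\otimes r_1}\otimes B^{\otimes r_2}$. By conversion [id_tpow] is the case
    [A = 1%:M]; with both matrices free, the actions on the two blocks compose. *)
Definition bop {r1 r2} (A B : mat R n) : tens R n (r1 + r2) -> tens R n (r1 + r2) :=
  tens_op (fun k : 'I_(r1 + r2) => if (k < r1)%N then A else B).

Lemma bop_comp r1 r2 (A B C D : mat R n) (T : tens R n (r1 + r2)) :
  bop A B (bop C D T) = bop (A *m C) (B *m D) T.
Proof.
by rewrite /bop tens_op_comp; apply: eq_tens_op => k; case: ifP.
Qed.

Lemma bop_tpow r1 r2 (A : mat R n) (T : tens R n (r1 + r2)) :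
  bop A A T = tpow A T.
Proof. by apply: eq_tens_op => k; case: ifP. Qed.

Definition lpart {r1 r2} (i : (r1 + r2).-tuple 'I_n) : r1.-tuple 'I_n :=
  [tuple tnth i (lshift r2 k) | k < r1].
Definition rpart {r1 r2} (i : (r1 + r2).-tuple 'I_n) : r2.-tuple 'I_n :=
  [tuple tnth i (rshift r1 k) | k < r2].

Lemma lpart_cat r1 r2 (i : r1.-tuple 'I_n) (j : r2.-tuple 'I_n) :
  lpart [tuple of i ++ j] = i.
Proof. by apply: eq_from_tnth => k; rewrite tnth_mktuple tnth_lshift. Qed.

Lemma rpart_cat r1 r2 (i : r1.-tuple 'I_n) (j : r2.-tuple 'I_n) :
  rpart [tuple of i ++ j] = j.
Proof. by apply: eq_from_tnth => k; rewrite tnth_mktuple tnth_rshift. Qed.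

Lemma cat_lrpart r1 r2 (i : (r1 + r2).-tuple 'I_n) :
  [tuple of lpart i ++ rpart i] = i.
Proof.
apply: eq_from_tnth => k; case: (split_ordP k) => l ->.
  by rewrite tnth_lshift tnth_mktuple.
by rewrite tnth_rshift tnth_mktuple.
Qed.

Lemma sum_tuple_cat r1 r2 (F : (r1 + r2).-tuple 'I_n -> R) :
  \sum_i F i = \sum_(i : r1.-tuple 'I_n) \sum_(j : r2.-tuple 'I_n) F [tuple of i ++ j].
Proof.
rewrite pair_bigA /=.
rewrite (reindex (fun p : r1.-tuple 'I_n * r2.-tuple 'I_n => [tuple of p.1 ++ p.2])) //=.
exists (fun i => (lpart i, rpart i)) => [[i j] _|i _].
  by rewrite lpart_cat rpart_cat.
by rewrite cat_lrpart.
Qed.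

Lemma bopE r1 r2 (A B : mat R n) (T : tens R n (r1 + r2))
    (i : r1.-tuple 'I_n) (j : r2.-tuple 'I_n) :
  bop A B T [tuple of i ++ j] =
  \sum_(i' : r1.-tuple 'I_n) \sum_(j' : r2.-tuple 'I_n)
    (\prod_k A (tnth i k) (tnth i' k)) * (\prod_k B (tnth j k) (tnth j' k)) *
      T [tuple of i' ++ j'].
Proof.
rewrite ffunE sum_tuple_cat; apply: eq_bigr => i' _; apply: eq_bigr => j' _.
rewrite big_split_ord /=; congr (_ * _ * _); apply: eq_bigr => k _.
  by rewrite /= ltn_ord !tnth_lshift.
by rewrite /= ltnNge leq_addr /= !tnth_rshift.
Qed.

Lemma prod_id r (i i' : r.-tuple 'I_n) :
  \prod_k (1%:M : mat R n) (tnth i k) (tnth i' k) = (i == i')%:R.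
Proof.
have [->|/eqP ii'] := eqVneq i i'.
  by rewrite big1 // => k _; rewrite mxE eqxx.
have [k kP] : exists k, tnth i k != tnth i' k.
  apply/existsP; rewrite -negb_forall; apply/negP => /forallP h.
  by apply: ii'; apply: eq_from_tnth => k; apply/eqP/h.
by rewrite (bigD1 k) //= mxE (negbTE kP) mul0r.
Qed.

(** Components with respect to the standard basis of the last [r2] factors. Slicing turns the
    kinematic integral into ordinary tensor valuations, to which the given bases apply. *)
Definition lslice {r1 r2} (T : tens R n (r1 + r2)) (j : r2.-tuple 'I_n) : tens R n r1 :=
  [ffun i : r1.-tuple 'I_n => T [tuple of i ++ j]].
Definition rslice {r1 r2} (T : tens R n (r1 + r2)) (i : r1.-tuple 'I_n) : tens R n r2 :=
  [ffun j : r2.-tuple 'I_n => T [tuple of i ++ j]].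

Lemma tpow_lslice r1 r2 (A : mat R n) (T : tens R n (r1 + r2)) j :
  tpow A (lslice T j) = lslice (bop A 1%:M T) j.
Proof.
apply/ffunP => i; rewrite [LHS]ffunE [RHS]ffunE bopE.
apply: eq_bigr => i' _; rewrite (bigD1 j) //= [X in _ + X]big1 ?addr0.
  by rewrite prod_id eqxx mulr1 ffunE.
by move=> j' jj'; rewrite prod_id eq_sym (negbTE jj') mulr0 mul0r.
Qed.

Lemma tpow_rslice r1 r2 (A : mat R n) (T : tens R n (r1 + r2)) i :
  tpow A (rslice T i) = rslice (bop 1%:M A T) i.
Proof.
apply/ffunP => j; rewrite [LHS]ffunE [RHS]ffunE bopE.
rewrite (bigD1 i) //= [X in _ + X]big1 ?addr0.
  by apply: eq_bigr => j' _; rewrite prod_id eqxx mul1r ffunE.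
move=> i' ii'; rewrite big1 // => j' _.
by rewrite prod_id eq_sym (negbTE ii') !mul0r.
Qed.

(** Embeds $S_{r_1}$ into $S_{r_1+r_2}$ as permutations of the first block, so that the symmetry of
    a tensor of rank [r1 + r2] can be used on its slices. *)
Definition lift_l_fun r1 r2 (s : 'S_r1) (k : 'I_(r1 + r2)) : 'I_(r1 + r2) :=
  match fintype.split k with inl a => lshift r2 (s a) | inr b => rshift r1 b end.
Definition lift_r_fun r1 r2 (s : 'S_r2) (k : 'I_(r1 + r2)) : 'I_(r1 + r2) :=
  match fintype.split k with inl a => lshift r2 a | inr b => rshift r1 (s b) end.

Lemma lift_l_inj r1 r2 (s : 'S_r1) : injective (@lift_l_fun r1 r2 s).
Proof.
apply: (can_inj (g := @lift_l_fun r1 r2 s^-1%g)) => k; rewrite /lift_l_fun.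
case: (split_ordP k) => a ->; last by rewrite !(unsplitK (inr _)).
by rewrite !(unsplitK (inl _)) permK.
Qed.

Lemma lift_r_inj r1 r2 (s : 'S_r2) : injective (@lift_r_fun r1 r2 s).
Proof.
apply: (can_inj (g := @lift_r_fun r1 r2 s^-1%g)) => k; rewrite /lift_r_fun.
case: (split_ordP k) => a ->; first by rewrite !(unsplitK (inl _)).
by rewrite !(unsplitK (inr _)) permK.
Qed.

(** The same matrix acts on all slots of the first block, so a permutation inside that block
    commutes with the operator. *)
Lemma lslice_bop_sym r1 r2 (A B : mat R n) (T : tens R n (r1 + r2)) j :
  symmetric_tensor T -> symmetric_tensor (lslice (bop A B T) j).
Proof.
move=> Tsym s i; rewrite [LHS]ffunE [RHS]ffunE.
rewrite -[RHS](@tens_op_permute _ _ _ (perm (@lift_l_inj r1 r2 s))) //.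
  congr (tens_op _ _ _); apply: eq_from_tnth => k; rewrite tnth_mktuple permE.
  rewrite /lift_l_fun; case: (split_ordP k) => a ->.
    by rewrite !tnth_lshift tnth_mktuple.
  by rewrite !tnth_rshift.
move=> k; rewrite permE /lift_l_fun; case: (split_ordP k) => a _ /=.
  by rewrite ltn_ord.
by rewrite ltnNge leq_addr.
Qed.

Lemma rslice_bop_sym r1 r2 (A B : mat R n) (T : tens R n (r1 + r2)) i :
  symmetric_tensor T -> symmetric_tensor (rslice (bop A B T) i).
Proof.
move=> Tsym s j; rewrite [LHS]ffunE [RHS]ffunE.
rewrite -[RHS](@tens_op_permute _ _ _ (perm (@lift_r_inj r1 r2 s))) //.
  congr (tens_op _ _ _); apply: eq_from_tnth => k; rewrite tnth_mktuple permE.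
  rewrite /lift_r_fun; case: (split_ordP k) => a ->.
    by rewrite !tnth_lshift.
  by rewrite !tnth_rshift tnth_mktuple.
move=> k; rewrite permE /lift_r_fun; case: (split_ordP k) => a _ /=.
  by rewrite ltn_ord.
by rewrite ltnNge leq_addr.
Qed.

End Tensors.

(** * Limits of matrices and of finite sums and products *)

Section Convergence.
Context {R : realType}.

Lemma cvg_mx {T : Type} {F : set_system T} {FF : Filter F} m n
    (f : T -> 'M[R]_(m, n)) (M : 'M[R]_(m, n)) :
  (forall i j, f t i j @[t --> F] --> M i j) -> f t @[t --> F] --> M.
Proof.
move=> fM; apply/cvg_ballP => e e0.
have : \near F, forall ij : 'I_m * 'I_n, ball (M ij.1 ij.2) e (f F ij.1 ij.2).
  by apply: filter_forall => -[i j]; have /cvg_ballP := fM i j; apply.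
by apply: filterS => t h; split => // i j; exact: (h (i, j)).
Qed.

Lemma cvg_sum {T I : Type} {F : set_system T} {FF : Filter F} (s : seq I)
    (f : I -> T -> R) (l : I -> R) :
  (forall i, f i t @[t --> F] --> l i) ->
  \sum_(i <- s) f i t @[t --> F] --> \sum_(i <- s) l i.
Proof.
move=> fl; elim: s => [|i s IH].
  by under eq_fun do rewrite big_nil; rewrite big_nil; exact: cvg_cst.
by under eq_fun do rewrite big_cons; rewrite big_cons; exact: cvgD.
Qed.

Lemma cvg_bigprod {T I : Type} {F : set_system T} {FF : Filter F} (s : seq I)
    (f : I -> T -> R) (l : I -> R) :
  (forall i, f i t @[t --> F] --> l i) ->
  \prod_(i <- s) f i t @[t --> F] --> \prod_(i <- s) l i.
Proof.
move=> fl; elim: s => [|i s IH].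
  by under eq_fun do rewrite big_nil; rewrite big_nil; exact: cvg_cst.
by under eq_fun do rewrite big_cons; rewrite big_cons; exact: cvgM.
Qed.

Lemma cvg_mulmx {T : Type} {F : set_system T} {FF : Filter F} m n p
    (f : T -> 'M[R]_(m, n)) (g : T -> 'M[R]_(n, p))
    (M : 'M[R]_(m, n)) (N : 'M[R]_(n, p)) :
  f t @[t --> F] --> M -> g t @[t --> F] --> N ->
  f t *m g t @[t --> F] --> M *m N.
Proof.
move=> fM gN; apply: cvg_mx => i j.
under eq_fun do rewrite mxE; rewrite mxE; apply: cvg_sum => k; apply: cvgM.
  exact: (cvg_comp _ _ fM (@coord_continuous _ _ _ i k M)).
exact: (cvg_comp _ _ gN (@coord_continuous _ _ _ k j N)).
Qed.

Lemma cvg_trmx {T : Type} {F : set_system T} {FF : Filter F} m n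
    (f : T -> 'M[R]_(m, n)) (M : 'M[R]_(m, n)) :
  f t @[t --> F] --> M -> (f t)^T @[t --> F] --> M^T.
Proof.
move=> fM; apply: cvg_mx => i j.
under eq_fun do rewrite mxE; rewrite mxE.
exact: (cvg_comp _ _ fM (@coord_continuous _ _ _ j i M)).
Qed.

End Convergence.

(** * Minkowski sums and linear images of convex bodies *)

Section ConvexBodies.
Context {R : realType} {n : nat}.
Implicit Types (K L M : set (vec R n)) (g h : mat R n) (x y : vec R n).

Lemma msumC K L : msum K L = msum L K.
Proof.
by apply/seteqP; split => z [x [y [Kx [Ly ->]]]]; exists y, x; rewrite addrC.
Qed.

Lemma msum_convex_body K L :
  convex_body K -> convex_body L -> convex_body (msum K L).
Proof.
move=> [[x Kx] [cK vK]] [[y Ly] [cL vL]]; split; first by exists (x + y), x, y.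
split.
  rewrite (_ : msum K L = (fun z : vec R n * vec R n => z.1 + z.2) @` (K `*` L)).
    apply: continuous_compact; last exact: compact_setX.
    by apply: continuous_subspaceT => z; exact: add_continuous.
  apply/seteqP; split => z; first by move=> [a [b [Ka [Lb ->]]]]; exists (a, b).
  by move=> [[a b] [/= Ka Lb] <-]; exists a, b.
move=> _ _ t [a [b [Ka [Lb ->]]]] [a' [b' [Ka' [Lb' ->]]]] t01.
exists (t *: a + (1 - t) *: a'), (t *: b + (1 - t) *: b').
split; first exact: vK; split; first exact: vL.
by rewrite !scalerDr addrACA.
Qed.

Lemma mat_img_convex_body g K : convex_body K -> convex_body (mat_img g K).
Proof.
move=> [[x Kx] [cK vK]]; split; first by exists (g *m x), x.
split.
  apply: continuous_compact => //; apply: continuous_subspaceT => z.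
  apply: (@cvg_mulmx _ _ (nbhs z) _ _ _ _ (fun=> g) id g z); first exact: cvg_cst.
  exact: cvg_id.
move=> _ _ t [a Ka <-] [b Kb <-] t01.
exists (t *: a + (1 - t) *: b); first exact: vK.
by rewrite mulmxDr -!scalemxAr.
Qed.

Lemma msum_translatel K M x : msum (translate K x) M = translate (msum K M) x.
Proof.
apply/seteqP; split => z.
  move=> [_ [b [[a Ka <-] [Mb ->]]]]; exists (a + b); first by exists a, b.
  by rewrite addrAC.
move=> [_ [a [b [Ka [Mb ->]]]] <-]; exists (a + x), b.
by rewrite addrAC; split => //; exists a.
Qed.

Lemma mat_img_translate g K x :
  mat_img g (translate K x) = translate (mat_img g K) (g *m x).
Proof.
apply/seteqP; split => z.
  by move=> [_ [a Ka <-] <-]; exists (g *m a); [exists a|rewrite mulmxDr].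
by move=> [_ [a Ka <-] <-]; exists (a + x); [exists a|rewrite mulmxDr].
Qed.

Lemma mat_img_comp g h K : mat_img g (mat_img h K) = mat_img (g *m h) K.
Proof.
apply/seteqP; split => z.
  by move=> [_ [y Ky <-] <-]; exists y => //; rewrite mulmxA.
by move=> [y Ky <-]; exists (h *m y); [exists y|rewrite mulmxA].
Qed.

Lemma mat_img_msum g K L : mat_img g (msum K L) = msum (mat_img g K) (mat_img g L).
Proof.
apply/seteqP; split => z.
  move=> [_ [a [b [Ka [Lb ->]]]] <-]; exists (g *m a), (g *m b).
  by rewrite mulmxDr; split; [exists a|split => //; exists b].
move=> [_ [_ [[a Ka <-] [[b Lb <-] ->]]]]; exists (a + b); first by exists a, b.
by rewrite mulmxDr.
Qed.

Lemma mat_img_setU g K L : mat_img g (K `|` L) = mat_img g K `|` mat_img g L.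
Proof. exact: image_setU. Qed.

Lemma mat_img_setI g K L : g \in unitmx ->
  mat_img g (K `&` L) = mat_img g K `&` mat_img g L.
Proof.
move=> gu; apply/seteqP; split => z.
  by move=> [a [Ka La] <-]; split; exists a.
move=> [[a Ka <-] [b Lb ba]]; exists a => //; split => //.
by rewrite -(mulKmx gu a) -ba mulKmx.
Qed.

Lemma msum_setUl K L M : msum (K `|` L) M = msum K M `|` msum L M.
Proof.
apply/seteqP; split => z.
  by move=> [a [b [[Ka|La] [Mb ->]]]]; [left|right]; exists a, b.
by move=> [|] [a [b [Ka [Mb ->]]]]; exists a, b; split => //; [left|right].
Qed.

(* A segment from [K] to [L] inside the convex set [K `|` L] meets [K `&` L]
   by connectedness; moving along it and, in the opposite direction, inside
   [M] keeps the sum constant. *)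
Lemma msum_setIl K L M : convex_body K -> convex_body L -> convex_body M ->
  convex_set (K `|` L) -> msum (K `&` L) M = msum K M `&` msum L M.
Proof.
move=> [_ [cK _]] [_ [cL _]] [_ [_ vM]] vKL; apply/seteqP; split => z.
  by move=> [a [b [[Ka La] [Mb ->]]]]; split; exists a, b.
move=> [[a [b [Ka [Mb ->]]]] [a' [b' [La' [Mb' ab]]]]].
pose p (t : R) : vec R n := t *: a + (1 - t) *: a'.
have pcont : continuous p.
  move=> t; apply: cvgD; first by apply: cvgZl; exact: cvg_id.
  by apply: cvgZl; apply: cvgB; [exact: cvg_cst|exact: cvg_id].
have KL (t : R) : t \in `[0, 1]%R -> (K `|` L) (p t).
  by rewrite in_itv => /= t01; exact: (vKL a a' t (or_introl Ka) (or_intror La')).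
have [t [t01 Kt Lt]] : exists t : R, [/\ t \in `[0, 1]%R, K (p t) & L (p t)].
  have cl (A : set (vec R n)) : compact A -> closed (p @^-1` A).
    move=> cA; apply: closed_comp; first by move=> t _; exact: pcont.
    by apply: compact_closed => //; exact: norm_hausdorff.
  have sg := @segment_connected R 0 1.
  (* Otherwise the parameters landing in [K] form a nonempty closed subset of $[0,1]$, which is also
     open there as the complement of those landing in [L]. By connectedness it contains 0, yet
     [p 0 = a'] lies in [L]. *)
  apply: contrapT => noKL.
  have e0 : ([set` `[0 : R, 1]%R] `&` (p @^-1` K)) !=set0.
    exists 1; split; rewrite /= ?in_itv/= ?lexx ?ler01//.
    by rewrite /p scale1r subrr scale0r addr0.
  have e1 : [set` `[0 : R, 1]%R] `&` (p @^-1` K) = [set` `[0, 1]%R] `&` ~` (p @^-1` L).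
    apply/seteqP; split => t [t01 Kt]; split => //.
      by move=> Lt; apply: noKL; exists t.
    by have [] := KL t t01.
  have e2 : exists2 C : set R, open C &
      [set` `[0 : R, 1]%R] `&` (p @^-1` K) = [set` `[0, 1]%R] `&` C.
    by exists (~` (p @^-1` L)) => //; apply: closed_openC; exact: cl.
  have e3 : exists2 C : set R, closed C &
      [set` `[0 : R, 1]%R] `&` (p @^-1` K) = [set` `[0, 1]%R] `&` C.
    by exists (p @^-1` K) => //; exact: cl.
  have /seteqP[_ /(_ 0)] := sg _ e0 e2 e3.
  have t0 : [set` `[0, 1]%R] (0 : R) by rewrite /= in_itv/= lexx ler01.
  move=> /(_ t0) [_ K0]; apply: noKL; exists 0; split => //.
  by rewrite /p scale0r add0r subr0 scale1r.
exists (p t), (t *: b + (1 - t) *: b'); split => //; split; first exact: vM.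
by rewrite /p addrACA -!scalerDr -ab -scalerDl [t + _]addrC subrK scale1r.
Qed.

End ConvexBodies.

(** * Continuity of $K+gL$ for Hausdorff convergence *)

Section Hausdorff.
Context {R : realType} {n : nat}.
Implicit Types (K L : set (vec R n)) (g : mat R n) (x : vec R n).

Lemma coord_le_norm {p q} (A : 'M[R]_(p, q)) i j : `|A i j| <= `|A|.
Proof.
rewrite [leRHS]/Num.norm /= mx_normrE.
exact: (le_bigmax_cond _ (fun ij => `|A ij.1 ij.2|) (isT : xpredT (i, j))).
Qed.

Lemma norm_le_coord {p q} (A : 'M[R]_(p, q)) (e : R) :
  0 <= e -> (forall i j, `|A i j| <= e) -> `|A| <= e.
Proof.
by move=> e0 Ae; rewrite [leLHS]/Num.norm /= mx_normrE; apply: bigmax_le => // ij _.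
Qed.

(** The norm is the maximum of the absolute entries, hence the factor [q%:R] from the inner sum. *)
Lemma norm_mulmx {p q r} (A : 'M[R]_(p, q)) (B : 'M[R]_(q, r)) :
  `|A *m B| <= q%:R * (`|A| * `|B|).
Proof.
apply: norm_le_coord => [|i j]; first by rewrite !mulr_ge0.
rewrite mxE (le_trans (ler_norm_sum _ _ _))//.
rewrite mulr_natl -[X in _ *+ X]card_ord -sumr_const; apply: ler_sum => k _.
by rewrite normrM ler_pM ?coord_le_norm.
Qed.

Lemma norm_le_enorm x : `|x| <= enorm x.
Proof.
apply: norm_le_coord => [|i j]; first exact: sqrtr_ge0.
rewrite (ord1 j) -sqrtr_sqr ler_wsqrtr// (bigD1 i)//= lerDl.
by apply: sumr_ge0 => k _; exact: sqr_ge0.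
Qed.

Lemma enorm_le_norm x : enorm x <= n%:R * `|x|.
Proof.
have h : 0 <= n%:R * `|x| by rewrite mulr_ge0.
rewrite -[leRHS](ger0_norm h) -sqrtr_sqr ler_wsqrtr// exprMn.
apply: (@le_trans _ _ (n%:R * `|x| ^+ 2)).
  rewrite mulr_natl -[X in _ *+ X]card_ord -sumr_const; apply: ler_sum => k _.
  by rewrite -[leLHS]real_normK ?num_real// ler_pXn2r ?nnegrE ?coord_le_norm.
rewrite ler_wpM2r ?sqr_ge0// -natrX ler_nat expnS.
by case: (n) => [//|m]; rewrite expn1 leq_pmulr.
Qed.

Lemma hausdorff_cvg_cst K : hausdorff_cvg (fun=> K) K.
Proof.
move=> e e0; apply: nearW => _.
have h0 x : enorm (x - x) <= e.
  rewrite subrr (le_trans (enorm_le_norm _))// normr0 mulr0; exact: ltW.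
by split => x Kx; exists x.
Qed.

(** With $g_k$ for [gs k], $(a+g_kb)-(a'+gb')=(a-a')+g_k(b-b')-(g-g_k)b'$. The terms are small by
    convergence of [Ks], of [Ls], and of [gs] together with boundedness of [L]. *)
Lemma hausdorff_cvg_msum_img (gs : nat -> mat R n) g (Ks Ls : nat -> set (vec R n)) K L :
  gs k @[k --> \oo] --> g -> (forall k, `|gs k| <= 1) -> compact L ->
  hausdorff_cvg Ks K -> hausdorff_cvg Ls L ->
  hausdorff_cvg (fun k => msum (Ks k) (mat_img (gs k) (Ls k))) (msum K (mat_img g L)).
Proof.
move=> gsg gs1 cL KsK LsL e e0.
have [B [B0 LB]] : exists B, 0 <= B /\ forall y, L y -> `|y| <= B.
  have [M [_ LM]] := compact_bounded cL; exists (`|M| + 1); split=> [|y Ly].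
    by rewrite addr_ge0.
  by apply: LM => //; rewrite (le_lt_trans (ler_norm M))// ltrDl.
(* The outer [n%:R] passes from the maximum norm to the Euclidean one; the summands bound the three
   terms of the splitting. Dividing by [C + 1] covers the case [C = 0]. *)
pose C : R := n%:R * (1 + n%:R + n%:R * B).
have C0 : 0 <= C by rewrite mulr_ge0// addr_ge0// ?mulr_ge0// addr_ge0.
pose d := e / (C + 1).
have d0 : 0 < d by rewrite divr_gt0// ltr_wpDl.
have Cd : C * d <= e.
  rewrite /d mulrCA ler_piMr ?ltW// ltr_pdivrMr ?ltr_wpDl// mul1r ltrDl//.
have key gk (a a' b b' : vec R n) : `|gk| <= 1 -> `|g - gk| <= d -> `|b'| <= B ->
    enorm (a - a') <= d -> enorm (b - b') <= d ->
    enorm ((a + gk *m b) - (a' + g *m b')) <= e.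
  move=> gk1 ggk b'B aa' bb'.
  apply: (le_trans (enorm_le_norm _)); apply: le_trans Cd; rewrite /C -mulrA.
  apply: ler_wpM2l => //.
  have -> : a + gk *m b - (a' + g *m b') =
      (a - a') + gk *m (b - b') - (g - gk) *m b'.
    by rewrite mulmxBr mulmxBl opprB -[RHS]addrA subrKA opprD addrACA.
  apply: (le_trans (ler_normB _ _)); rewrite mulrDl lerD//.
    apply: (le_trans (ler_normD _ _)); rewrite mulrDl mul1r lerD//.
      exact: (le_trans (norm_le_enorm _)).
    apply: (le_trans (norm_mulmx _ _)); rewrite ler_wpM2l//.
    apply: (@le_trans _ _ (1 * d)); last by rewrite mul1r.
    by rewrite ler_pM//; exact: (le_trans (norm_le_enorm _)).
  apply: (le_trans (norm_mulmx _ _)); rewrite -mulrA ler_wpM2l// mulrC.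
  by rewrite ler_pM.
have gsd : \forall k \near \oo, `|g - gs k| <= d by move/cvgrPdist_le : gsg; apply.
near=> k.
have [KsK1 KsK2] : hausdorff_le (Ks k) K d by near: k; exact: KsK.
have [LsL1 LsL2] : hausdorff_le (Ls k) L d by near: k; exact: LsL.
have gd : `|g - gs k| <= d by near: k; exact: gsd.
split.
  move=> _ [a [_ [Ka [[b Lb <-] ->]]]].
  have [a' [Ka' aa']] := KsK1 _ Ka; have [b' [Lb' bb']] := LsL1 _ Lb.
  exists (a' + g *m b'); split; last by apply: key => //; exact: LB.
  by exists a', (g *m b'); split => //; split => //; exists b'.
move=> _ [a' [_ [Ka' [[b' Lb' <-] ->]]]].
have [a [Ka aa']] := KsK2 _ Ka'; have [b [Lb bb']] := LsL2 _ Lb'.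
exists (a + gs k *m b); split; last by apply: key => //; exact: LB.
by exists a, (gs k *m b); split => //; split => //; exists b.
Unshelve. all: by end_near. Qed.

End Hausdorff.

(** * From sequences to neighbourhoods *)

Section SequentialNear.
Context {R : realType}.

(** By contraposition: if the conclusion fails, each ball of radius $1/(j+1)$ contains a point that
    is bad for some index at least [j]. The sequence so chosen is bad at every [j], so a single good
    [j] contradicts it. *)
Lemma seq_near {X : pseudoMetricType R} (x : X) (P : nat -> X -> Prop) :
  (forall (y : nat -> X) (k : nat -> nat), y j @[j --> \oo] --> x ->
     (forall j, (j <= k j)%N) -> exists j, P (k j) (y j)) ->
  \forall x' \near x & i \near \oo, P i x'.
Proof.
move=> seqP; apply: contrapT => nP.
have bad j : exists p : X * nat,
    [/\ ball x j.+1%:R^-1 p.1, (j <= p.2)%N & ~ P p.2 p.1].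
  apply: contrapT => /forallNP h; apply: nP.
  exists (ball x (j.+1%:R^-1 : R), [set i | (j <= i)%N]).
    split => /=; first by apply: nbhsx_ballx; rewrite invr_gt0.
    by exists j.
  move=> [y i] [/= yx ji]; apply: contrapT => nPi.
  by apply: (h (y, i)); split.
have [f fP] := choice bad.
have [j Pj] : exists j, P (f j).2 (f j).1.
  apply: (seqP (fun j => (f j).1) (fun j => (f j).2)) => [|j]; last by have [] := fP j.
  apply/cvg_ballP => e e0; near=> j; have [+ _ _] := fP j.
  apply: le_ball; apply: ltW; near: j; exact: (near_infty_natSinv_lt (PosNum e0)).
by have [_ _] := fP j.
Unshelve. all: by end_near. Qed.

End SequentialNear.

(** * Compactness of the group *)

Section OrthogonalGroup.
Context {R : realType} {n : nat}.
Implicit Types (G : set (mat R n)) (g : mat R n).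

Lemma SO_inv g : SO_mem g -> invmx g = g^T.
Proof.
move=> [gg _]; have /mulmx1_unit[_ gu] := gg.
by rewrite -[RHS](mulmxK gu) gg mul1mx.
Qed.

Lemma SO_unitmx g : SO_mem g -> g \in unitmx.
Proof. by move=> [/mulmx1_unit[]]. Qed.

(** The columns of an orthogonal matrix are unit vectors. *)
Lemma SO_norm_le1 g : SO_mem g -> `|g| <= 1.
Proof.
move=> [gg _]; apply: norm_le_coord => // i j.
rewrite -(@ler_pXn2r _ 2) ?nnegrE// expr1n real_normK ?num_real//.
have := congr1 (fun M : mat R n => M j j) gg; rewrite !mxE eqxx mulr1n => <-.
rewrite (bigD1 i)//= mxE -expr2 lerDl; apply: sumr_ge0 => k _.
by rewrite mxE -expr2 sqr_ge0.
Qed.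

(** Heine-Borel, transported from row vectors: [A] is closed inside the continuous image of a cube
    under [vec_mx]. *)
Lemma mx_bounded_closed_compact m p (A : set 'M[R]_(m, p)) (c : R) :
  closed A -> (forall M, A M -> `|M| <= c) -> compact A.
Proof.
move=> cA Ac; pose B : set 'rV[R]_(m * p) := [set v | forall i, v ord0 i \in `[- c, c]%R].
have cB : compact B.
  by apply: (@rV_compact _ _ (fun=> `[- c, c]%classic)) => i; exact: segment_compact.
apply: (@subclosed_compact _ A (vec_mx @` B)) => // [|M AM]; last first.
  exists (mxvec M); last exact: mxvecK.
  move=> i; case/mxvec_indexP: i => i j.
  by rewrite mxvecE in_itv/= -ler_norml (le_trans (coord_le_norm _ _ _))// Ac.
apply: continuous_compact => //; apply: continuous_subspaceT => v.
have -> : vec_mx = fun v : 'rV[R]_(m * p) => \matrix_(i, j) v ord0 (mxvec_index i j).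
  by apply/funext => w; apply/matrixP => i j; rewrite !mxE ord1.
apply: (@cvg_mx R _ (nbhs v)) => i j; under eq_fun do rewrite mxE.
by rewrite mxE; exact: coord_continuous.
Qed.

Lemma closed_conn_subgroup_compact G : closed_conn_subgroup_SO G -> compact G.
Proof.
move=> [_ _ _ Gso [cG _]]; apply: (@mx_bounded_closed_compact _ _ _ 1) => // g Gg.
by apply: SO_norm_le1; exact: Gso.
Qed.

End OrthogonalGroup.

(* Values outside [G] are irrelevant throughout, so continuity on [G] is
   stated for sequences lying in [G]. *)
Definition seq_cont {R : realType} {n : nat} (G : set (mat R n)) (f : mat R n -> R) :=
  forall (x : nat -> mat R n) y, (forall k, G (x k)) -> G y ->
    x k @[k --> \oo] --> y -> f (x k) @[k --> \oo] --> f y.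

(** * Integration over the group: translation, inversion and limits *)

Section Haar.
Context {R : realType} {n : nat} {G : set (mat R n)} {mu : probability (matB R n) R}.
Hypothesis GSO : closed_conn_subgroup_SO G.
Hypothesis muG : haar_prob G mu.
Implicit Types (f : mat R n -> R) (g : mat R n).

Let I f : R := Rintegral mu (G : set (matB R n)) f.

Let GM g h : G g -> G h -> G (g *m h). Proof. by case: GSO => _ + _ _ _; exact. Qed.
Let GT g : G g -> G g^T.
Proof. by case: GSO => _ _ GV Gso _ Gg; rewrite -SO_inv; [exact: GV|exact: Gso]. Qed.
Let GTK g : G g -> g^T *m g = 1%:M.
Proof. by case: GSO => _ _ _ Gso _ /Gso[]. Qed.
Let cG : compact G. Proof. exact: closed_conn_subgroup_compact. Qed.

Lemma mat_open_measurable (U : set (mat R n)) :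
  open U -> measurable (U : set (matB R n)).
Proof. by move=> oU; apply: sub_sigma_algebra. Qed.

Lemma measurable_group : measurable (G : set (matB R n)).
Proof.
rewrite -[G]setCK; apply: measurableC; apply: mat_open_measurable.
by apply: closed_openC; case: GSO => _ _ _ _ [].
Qed.

Lemma seq_cont_within f : seq_cont G f -> {within G, continuous f}.
Proof.
move=> cf; apply/subspace_continuousP => x Gx; apply/cvgrPdist_le => e e0.
(* The index [i] is a dummy here. A sequence that leaves [G] satisfies the implication vacuously at
   a point outside [G]. *)
have h : \forall x' \near x & i \near \oo,
    (fun (i : nat) x' => G x' -> `|f x - f x'| <= e) i x'.
  apply: seq_near => y k yx _.
  have [Gy|/existsNP[j nG]] := pselect (forall j, G (y j)); last by exists j.
  have /cvgrPdist_le/(_ _ e0)[N _ NP] := cf y x Gy Gx yx.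
  by exists N => _; exact: (NP N (leqnn N)).
case: h => -[U V] [/= nU [N _ NV] UV].
apply: filterS nU => x' Ux' Gx'; apply: (UV (x', N)) => //; split => //.
exact: (NV N (leqnn N)).
Qed.

Lemma seq_cont_measurable f : seq_cont G f ->
  measurable_fun (G : set (matB R n)) (f : matB R n -> R).
Proof.
move=> /seq_cont_within/continuousP cf.
apply: (measurability _ (RGenOpens.measurableE R)).
move=> _ [_ [a [b ->] <-]].
have /open_subspaceP[U oU UG] : open (f @^-1` `]a, b[ : set (subspace G)).
  exact/cf/interval_open.
rewrite setIC -UG; apply: measurableI; first exact: mat_open_measurable.
exact: measurable_group.
Qed.

(** Continuity on the compact [G] gives boundedness, and the measure is finite. Subsets [A] are
    allowed because the Riemann sums below cut [G] into pieces. *)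
Lemma seq_cont_integrable f (A : set (matB R n)) : seq_cont G f ->
  measurable A -> A `<=` (G : set (matB R n)) -> mu.-integrable A (EFin \o f).
Proof.
move=> cf mA AG; apply: (integrableS measurable_group mA AG).
apply: measurable_bounded_integrable; first exact: measurable_group.
- by rewrite (le_lt_trans (probability_le1 _ measurable_group))// ltry.
- exact: seq_cont_measurable.
have /compact_bounded[M [_ Mf]] := continuous_compact (seq_cont_within cf) cG.
by exists M; split; rewrite ?num_real // => ? ? ? ?; exact: Mf.
Qed.

Lemma seq_cont_cst (c : R) : seq_cont G (fun=> c).
Proof. by move=> x y _ _ _; exact: cvg_cst. Qed.

Lemma seq_contD f f' : seq_cont G f -> seq_cont G f' ->
  seq_cont G (fun x => f x + f' x).
Proof. by move=> cf cf' x y Gx Gy xy; apply: cvgD; [exact: cf|exact: cf']. Qed.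

Lemma seq_contZ (c : R) f : seq_cont G f -> seq_cont G (fun x => c * f x).
Proof. by move=> cf x y Gx Gy xy; apply: cvgMr; exact: cf. Qed.

Lemma seq_cont_sum {J : Type} (s : seq J) (F : J -> mat R n -> R) :
  (forall j, seq_cont G (F j)) -> seq_cont G (fun x => \sum_(j <- s) F j x).
Proof. by move=> cF x y Gx Gy xy; apply: cvg_sum => j; exact: cF. Qed.

Lemma seq_cont_mull f g : G g -> seq_cont G f -> seq_cont G (fun x => f (g *m x)).
Proof.
move=> Gg cf x y Gx Gy xy; apply: cf => [k||]; [exact: GM|exact: GM|].
by apply: cvg_mulmx => //; exact: cvg_cst.
Qed.

Lemma seq_cont_mulr f g : G g -> seq_cont G f -> seq_cont G (fun x => f (x *m g)).
Proof.
move=> Gg cf x y Gx Gy xy; apply: cf => [k||]; [exact: GM|exact: GM|].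
by apply: cvg_mulmx => //; exact: cvg_cst.
Qed.

Lemma seq_cont_tr f : seq_cont G f -> seq_cont G (fun x => f x^T).
Proof.
move=> cf x y Gx Gy xy; apply: cf => [k||]; [exact: GT|exact: GT|].
exact: cvg_trmx.
Qed.

Lemma Rintegral_dist_le (A : set (matB R n)) f f' (e : R) :
  measurable A -> A `<=` (G : set (matB R n)) -> seq_cont G f -> seq_cont G f' ->
  (forall x, A x -> `|f x - f' x| <= e) ->
  `|Rintegral mu A f - Rintegral mu A f'| <= e * fine (mu A).
Proof.
move=> mA AG cf cf' ff'.
have intf := seq_cont_integrable cf mA AG.
have intf' := seq_cont_integrable cf' mA AG.
have cB : seq_cont G (fun x => f x - f' x).
  move=> x y Gx Gy xy; apply: cvgB; [exact: cf|exact: cf'].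
have intB := seq_cont_integrable cB mA AG.
rewrite -RintegralB//; apply: (le_trans (le_normr_Rintegral mA intB)).
rewrite -Rintegral_cst//; apply: le_Rintegral => //.
- exact: (integrable_abse intB).
- by apply: (@seq_cont_integrable (fun=> e)) => //; exact: seq_cont_cst.
Qed.

Let fin_muG : fine (mu (G : set (matB R n))) = 1.
Proof. by case: muG => -> _. Qed.

Lemma Haar_dist_le f f' (e : R) : seq_cont G f -> seq_cont G f' ->
  (forall x, G x -> `|f x - f' x| <= e) -> `|I f - I f'| <= e.
Proof.
move=> cf cf' ff'; rewrite -[leRHS]mulr1 -fin_muG.
by apply: Rintegral_dist_le => //; exact: measurable_group.
Qed.

Lemma HaarD f f' : seq_cont G f -> seq_cont G f' ->
  I (fun x => f x + f' x) = I f + I f'.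
Proof.
move=> cf cf'; apply: RintegralD; first exact: measurable_group.
  by apply: seq_cont_integrable => //; exact: measurable_group.
by apply: seq_cont_integrable => //; exact: measurable_group.
Qed.

Lemma HaarZ (c : R) f : seq_cont G f -> I (fun x => c * f x) = c * I f.
Proof.
move=> cf; apply: RintegralZl; first exact: measurable_group.
by apply: seq_cont_integrable => //; exact: measurable_group.
Qed.

Lemma Haar_sum {J : Type} (s : seq J) (F : J -> mat R n -> R) :
  (forall j, seq_cont G (F j)) ->
  I (fun x => \sum_(j <- s) F j x) = \sum_(j <- s) I (F j).
Proof.
move=> cF; elim: s => [|j s IH].
  rewrite big_nil (_ : (fun x => _) = fun=> 0); last first.
    by apply/funext => x; rewrite big_nil.
  by rewrite /I Rintegral_cst ?mul0r//; exact: measurable_group.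
rewrite big_cons -IH -HaarD//; last exact: seq_cont_sum.
by congr I; apply/funext => x; rewrite big_cons.
Qed.

(** [haar_prob] says that the push-forward of [mu] under left multiplication by [g] agrees with [mu]
    on measurable sets; the change of variables carries this to integrals. *)
Lemma Haar_mull f g : G g -> seq_cont G f -> I (fun x => f (g *m x)) = I f.
Proof.
move=> Gg cf; pose phi (x : matB R n) : matB R n := g *m (x : mat R n).
have mphi : measurable_fun setT phi.
  apply: (@measurability _ _ (matB R n) (matB R n) setT phi
    (fun A : set (mat R n) => open A)) => //.
  move=> _ [U oU <-]; rewrite setTI; apply: mat_open_measurable.
  apply: (@open_comp (mat R n) (mat R n) phi) => // x _.
  apply: (@cvg_mulmx _ _ (nbhs (x : mat R n)) _ _ _ _ (fun=> g) id g x).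
    exact: cvg_cst.
  exact: cvg_id.
(* Extension by zero: measurability of [f] is known on [G] only, and the change of variables is
   applied to a function measurable everywhere. *)
pose F : matB R n -> R := (f : matB R n -> R) \_ (G : set (matB R n)).
have mF : measurable_fun setT F.
  by apply/(measurable_restrictT _ measurable_group); exact: seq_cont_measurable.
have mf : @measurable_fun _ _ (matB R n) (\bar R) setT (EFin \o F).
  exact/measurable_EFinP.
have phiG : phi @^-1` (G : set (matB R n)) = G.
  apply/seteqP; split => x; rewrite /phi /=; last exact: GM.
  by move=> Ggx; rewrite -[x]mul1mx -(GTK Gg) -mulmxA; apply: GM => //; exact: GT.
have intf : mu.-integrable (phi @^-1` (G : set (matB R n))) ((EFin \o F) \o phi).
  rewrite phiG; apply: (eq_integrable measurable_group (EFin \o (fun x => f (g *m x)))) => //.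
  - move=> x; rewrite inE => Gx /=; rewrite /F /restrict/= mem_set//; exact: GM.
  - apply: seq_cont_integrable => //; last exact: measurable_group.
    exact: seq_cont_mull.
rewrite /I /Rintegral; congr fine.
transitivity (\int[mu]_(x in G) ((EFin \o F) \o phi) x)%E.
  apply: eq_integral => x; rewrite inE => Gx /=.
  by rewrite /F /restrict/= mem_set//; exact: GM.
rewrite -[in LHS]phiG -(integral_pushforward mphi)//; last exact: measurable_group.
transitivity (\int[mu]_(x in G) (EFin \o F) x)%E; last first.
  by apply: eq_integral => x xG; rewrite /= /F /restrict/= xG.
apply: eq_measure_integral => A mA AG.
by case: muG => _ /(_ g A Gg mA).
Qed.

(** The points whose right translate of [f] is uniformly [e]-close to the one at [y]. The guard
    [G y'] admits all matrices outside [G], so that the set can be a neighbourhood of [y] in the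
    full matrix space. *)
Let osc f (e : R) (y : mat R n) : set (mat R n) :=
  [set y' | G y' -> forall x, G x -> `|f (x *m y') - f (x *m y)| <= e].

(** Tube argument: $(x,y')\mapsto f(xy')$ is jointly continuous on [G], and compactness in [x] makes
    the estimate at [y] uniform. *)
Lemma small_oscillation f (e : R) y : seq_cont G f -> 0 < e -> G y ->
  nbhs y (osc f e y).
Proof.
move=> cf e0 Gy.
have /compact_near_coveringP cov := cG.
have : \forall y' \near y,
    G `<=` (fun x => G x -> G y' -> `|f (x *m y') - f (x *m y)| <= e).
  apply: (cov _ (nbhs y)
    (fun y' x => G x -> G y' -> `|f (x *m y') - f (x *m y)| <= e)) => x Gx.
  have h : \forall p \near (x, y) & i \near \oo,
      (fun (i : nat) (p : mat R n * mat R n) => G p.1 -> G p.2 ->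
         `|f (p.1 *m p.2) - f (p.1 *m y)| <= e) i p.
    apply: seq_near => p k pxy _.
    have [Gp|/existsNP[j nG]] := pselect (forall j, G (p j).1 /\ G (p j).2); last first.
      by exists j => G1' G2'; case: nG.
    have p1 : (p j).1 @[j --> \oo] --> x.
      exact: (cvg_comp _ _ pxy (@cvg_fst _ _ _ _ _)).
    have p2 : (p j).2 @[j --> \oo] --> y.
      exact: (cvg_comp _ _ pxy (@cvg_snd _ _ _ _ _)).
    have f1 : f ((p j).1 *m (p j).2) @[j --> \oo] --> f (x *m y).
      by apply: cf; [move=> j; apply: GM; case: (Gp j)|exact: GM|exact: cvg_mulmx].
    have f2 : f ((p j).1 *m y) @[j --> \oo] --> f (x *m y).
      apply: cf; [by move=> j; apply: GM => //; case: (Gp j)|exact: GM|].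
      by apply: cvg_mulmx => //; exact: cvg_cst.
    have : f ((p j).1 *m y) - f ((p j).1 *m (p j).2) @[j --> \oo] --> (0 : R).
      by rewrite -(subrr (f (x *m y))); exact: cvgB.
    move=> /cvgrPdist_le/(_ _ e0)[N _ NP].
    exists N => _ _; have := NP N (leqnn N).
    by rewrite /= sub0r opprB.
  case: h => -[U V] [/= nU [N _ NV] UV].
  apply: filterS (nU : (filter_prod (nbhs x) (nbhs y)) U) => -[x' y'] /= Uxy Gx' Gy'.
  by apply: (UV ((x', y'), N)) => //; split => //; exact: (NV N (leqnn N)).
by apply: filterS => y' h Gy' x Gx; exact: (h x Gx Gx Gy').
Qed.

(** Induction on the centres: the part of [A] near the first centre [y] contributes a term at [y]
    weighted by its measure, and the remaining centres cover the rest. Interiors keep the pieces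
    measurable. *)
Lemma Riemann_sum_cover f (e : R) (s : seq (mat R n)) (A : set (matB R n)) :
  seq_cont G f -> 0 <= e -> {in s, forall y, G y} ->
  measurable A -> A `<=` (G : set (matB R n)) ->
  (forall x, A x -> exists2 y, y \in s & (osc f e y)° x) ->
  exists ws : seq (R * mat R n), [/\ forall p, p \in ws -> G p.2,
    \sum_(p <- ws) p.1 = fine (mu A) &
    forall x, G x ->
      `|Rintegral mu A (fun y => f (x *m y)) - \sum_(p <- ws) p.1 * f (x *m p.2)|
        <= e * fine (mu A)].
Proof.
move=> cf e0; elim: s A => [|y s IH] A Gs mA AG cov.
  have -> : A = set0 by apply/seteqP; split => // x /cov[].
  exists [::]; split => //; first by rewrite big_nil measure0.
  by move=> x Gx; rewrite big_nil Rintegral_set0 measure0 subrr normr0 mulr0.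
pose U : set (matB R n) := (osc f e y)°.
have mU : measurable U by apply: mat_open_measurable; exact: open_interior.
have mA1 : measurable (A `&` U) by exact: measurableI.
have mA2 : measurable (A `\` U) by exact: measurableD.
have A1G : A `&` U `<=` (G : set (matB R n)) by move=> x [/AG].
have A2G : A `\` U `<=` (G : set (matB R n)) by move=> x [/AG].
have dA : [disjoint A `&` U & A `\` U].
  by apply/disj_setPS => x [[_ Ux] [_ nUx]].
have [||ws [Gws sws Iws]] := IH (A `\` U) _ mA2 A2G.
- by move=> z zs; apply: Gs; rewrite inE zs orbT.
- move=> x [Ax nUx]; have [z] := cov x Ax.
  by rewrite inE => /orP[/eqP -> //|zs Uz]; exists z.
have Gy : G y by apply: Gs; rewrite inE eqxx.
have finA B : measurable B -> mu B \is a fin_num.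
  by move=> mB; exact: fin_num_measure.
have muA : fine (mu A) = fine (mu (A `&` U)) + fine (mu (A `\` U)).
  rewrite -{1}(setUIDK A U) measureU//; last exact/disj_set2P.
  by rewrite fineD ?finA.
exists ((fine (mu (A `&` U)), y) :: ws); split.
- by move=> p; rewrite inE => /orP[/eqP -> //|]; exact: Gws.
- by rewrite big_cons sws muA.
move=> x Gx; rewrite big_cons /= muA mulrDr.
rewrite -{1}(setUIDK A U) Rintegral_setU//; last first.
  rewrite setUIDK; apply: (@seq_cont_integrable (fun y => f (x *m y))) => //.
  exact: seq_cont_mull.
rewrite opprD addrACA (le_trans (ler_normD _ _))// lerD//; last exact: Iws.
rewrite [_ * f _]mulrC -(Rintegral_cst mu mA1).
apply: (@Rintegral_dist_le _ (fun y => f (x *m y)) (fun=> f (x *m y))) => //.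
- exact: seq_cont_mull.
- exact: seq_cont_cst.
by move=> z [Az /interior_subset]; apply => //; exact: AG.
Qed.

Lemma Riemann_sum f (e : R) : seq_cont G f -> 0 < e ->
  exists ws : seq (R * mat R n), [/\ forall p, p \in ws -> G p.2,
    \sum_(p <- ws) p.1 = 1 &
    forall x, G x -> `|I f - \sum_(p <- ws) p.1 * f (x *m p.2)| <= e].
Proof.
move=> cf e0; have := cG; rewrite compact_cover => cov.
have [||D DG Dcov] := cov (mat R n) G (fun y => (osc f e y)°).
- by move=> y _; exact: open_interior.
- by move=> y Gy; exists y => //; exact: small_oscillation.
have [|||ws [Gws sws Iws]] :=
    @Riemann_sum_cover f e (finmap.enum_fset D) G cf (ltW e0) _ measurable_group.
- by move=> y yD; have := DG y yD; rewrite inE.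
- by [].
- by move=> x /Dcov[y yD Uy]; exists y.
exists ws; split => //; first by rewrite sws fin_muG.
(* Left invariance makes the integral of $y\mapsto f(xy)$ independent of [x]. *)
by move=> x Gx; have := Iws x Gx; rewrite -/(I _) Haar_mull// fin_muG mulr1.
Qed.

(* Left invariance gives [I f] as a limit of sums of right translates of [f]
   which is uniform on [G]; evaluating at [x^T] and integrating in [x] turns
   each translate into the integral of [f \o trmx]. *)
Lemma Haar_tr f : seq_cont G f -> I (fun x => f x^T) = I f.
Proof.
move=> cf; apply/eqP; rewrite eq_sym -subr_eq0 -normr_le0.
apply/ler_addgt0Pl => e e0; rewrite addr0.
have [ws [Gws sws Iws]] := Riemann_sum cf e0.
(* The guard makes [F p] continuous for every [p], as [Haar_sum] requires; only the points listed in
   [ws] are known to lie in [G]. *)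
pose F (p : R * mat R n) : mat R n -> R :=
  if p \in ws then fun x => p.1 * f (x^T *m p.2) else fun=> 0.
have cF p : seq_cont G (F p).
  rewrite /F; case: ifP => [pws|_]; last exact: seq_cont_cst.
  by apply: seq_contZ; apply: (seq_cont_tr (seq_cont_mulr (Gws p pws) cf)).
have IF : I (fun x => \sum_(p <- ws) F p x) = I (fun x => f x^T).
  rewrite Haar_sum// -[RHS]mul1r -sws mulr_suml; apply: eq_big_seq => p pws.
  rewrite /F pws HaarZ; last exact: (seq_cont_tr (seq_cont_mulr (Gws p pws) cf)).
  congr (_ * _).
  (* Since $x^Tp=(p^Tx)^T$, the translate is a left translate of $x\mapsto f(x^T)$. *)
  rewrite -(@Haar_mull (fun x => f x^T) (p.2)^T); last exact: seq_cont_tr.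
    by congr I; apply/funext => x; rewrite trmx_mul trmxK.
  by apply: GT; exact: Gws.
rewrite -IF -[I f]mulr1 -fin_muG -(Rintegral_cst mu measurable_group).
apply: Haar_dist_le; [exact: seq_cont_cst|exact: seq_cont_sum|move=> x Gx].
rewrite (eq_big_seq (fun p => p.1 * f (x^T *m p.2))); first exact/Iws/GT.
by move=> p pws; rewrite /F pws.
Qed.

(** Transposition, which is inversion on [G], exchanges right and left translations. *)
Lemma Haar_mulr f g : G g -> seq_cont G f -> I (fun x => f (x *m g)) = I f.
Proof.
move=> Gg cf; rewrite -(Haar_tr (seq_cont_mulr Gg cf)) -(Haar_tr cf).
rewrite -(@Haar_mull (fun x => f x^T) g^T); [|exact: GT|exact: seq_cont_tr].
by congr I; apply/funext => x; rewrite trmx_mul trmxK.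
Qed.

(** The last hypothesis is continuous convergence, which is uniform on the compact [G]. The index
    map [k] matches the indices produced by [seq_near]. *)
Lemma Haar_cvg (fs : nat -> mat R n -> R) f :
  (forall k, seq_cont G (fs k)) -> seq_cont G f ->
  (forall x y (k : nat -> nat), (forall j, G (x j)) -> G y ->
     x j @[j --> \oo] --> y -> (forall j, (j <= k j)%N) ->
     fs (k j) (x j) @[j --> \oo] --> f y) ->
  I (fs k) @[k --> \oo] --> I f.
Proof.
move=> cfs cf fsf; apply/cvgrPdist_le => e e0.
have /compact_near_coveringP cov := cG.
have : \forall k \near \oo, G `<=` (fun x => G x -> `|f x - fs k x| <= e).
  apply: (cov _ \oo (fun k x => G x -> `|f x - fs k x| <= e)) => x Gx.
  apply: seq_near => y k yx jk.
  have [Gy|/existsNP[j nG]] := pselect (forall j, G (y j)); last by exists j.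
  have : f (y j) - fs (k j) (y j) @[j --> \oo] --> (0 : R).
    rewrite -(subrr (f x)); apply: cvgB; first exact: (cf y x Gy Gx yx).
    exact: (fsf y x k Gy Gx yx jk).
  move=> /cvgrPdist_le/(_ _ e0)[N _ NP].
  by exists N => _; have := NP N (leqnn N); rewrite /= sub0r normrN.
apply: filterS => k h; apply: Haar_dist_le => // x Gx; exact: h.
Qed.

End Haar.

(** Greedy choice: while fewer than [m] points are chosen, some nonzero combination of the functions
    vanishes at all of them; independence gives a point where it does not vanish, and adding that
    point raises the rank. *)
Lemma dual_points {K : fieldType} {X : Type} (dom : X -> Prop) (m : nat)
    (u : 'I_m -> X -> K) :
  (forall a : 'I_m -> K,
     (forall x, dom x -> \sum_(b < m) a b * u b x = 0) -> forall b, a b = 0) ->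
  exists x : 'I_m -> X, (forall c, dom (x c)) /\
    \matrix_(c < m, b < m) u b (x c) \in unitmx.
Proof.
move=> indep.
have step k : (k <= m)%N -> exists x : 'I_k -> X, (forall c, dom (x c)) /\
    \rank (\matrix_(c < k, b < m) u b (x c)) = k.
  elim: k => [_|k IH km].
    have x0 (i : 'I_0) : X by case: i.
    exists x0; split; first by case.
    by apply/eqP; rewrite -leqn0 rank_leq_row.
  have [x [domx]] := IH (ltnW km); set A := \matrix_(_, _) _ => rA.
  have : cokermx A != 0 by rewrite -mxrank_eq0 mxrank_coker rA -lt0n subn_gt0.
  case/matrix0Pn => b0 [j0 nz0].
  (* The rank of [A] is [k < m], so its cokernel has a nonzero column: the coefficients of a
     combination vanishing at the points chosen so far. *)
  pose v := col j0 (cokermx A).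
  have Av : A *m v = 0 by rewrite /v colE mulmxA mulmx_coker mul0mx.
  have [x0 dx0 ux0] : exists2 x0, dom x0 & \sum_(b < m) v b 0 * u b x0 <> 0.
    apply: contrapT => h; have : v b0 0 = 0.
      apply: (indep (fun b => v b 0)) => y dy.
      by apply: contrapT => uy; apply: h; exists y.
    by rewrite mxE => /eqP; rewrite (negbTE nz0).
  pose y (c : 'I_(k + 1)) := match fintype.split c with inl c' => x c' | inr _ => x0 end.
  pose r : 'M[K]_(1, m) := \row_b u b x0.
  have yE : \matrix_(c < k + 1, b < m) u b (y c) = col_mx A r.
    apply/matrixP => c b; rewrite !mxE /y.
    by case: (fintype.split c) => c'; rewrite mxE.
  rewrite -[k.+1]addn1; exists y; split=> [c|].
    by rewrite /y; case: (fintype.split c).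
  rewrite yE; apply/eqP; rewrite eqn_leq rank_leq_row /=.
  apply: (@leq_trans (\rank A).+1); first by rewrite rA addn1.
  rewrite -addsmxE; apply: rank_ltmx; rewrite ltmxE addsmxSl addsmx_sub submx_refl /=.
  apply/negP => /submxP[D rD]; apply: ux0.
  have : (r *m v) 0 0 = 0 by rewrite rD -mulmxA Av mulmx0 mxE.
  by rewrite mxE => rv; rewrite -[RHS]rv; apply: eq_bigr => b _; rewrite [r 0 b]mxE mulrC.
have [x [domx rx]] := step m (leqnn m).
by exists x; split => //; rewrite -row_free_unit /row_free rx.
Qed.

(** * The kinematic integral as a valuation in each variable *)

Section AdditiveKinematic.
Context {R : realType} {n : nat} {G : set (mat R n)} {mu : probability (matB R n) R}.
Context {r1 r2 : nat} {Phi : set (vec R n) -> tens R n (r1 + r2)}.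
Hypothesis GSO : closed_conn_subgroup_SO G.
Hypothesis muG : haar_prob G mu.
Hypothesis PhiG : is_G_valuation G Phi.
Implicit Types (K L : set (vec R n)) (g h : mat R n) (i : (r1 + r2).-tuple 'I_n).

Let F K L := add_kin G mu Phi K L.
Let f K L i (h : mat R n) : R :=
  bop 1%:M h (Phi (msum K (mat_img (invmx h) L))) i.

Let FE K L i : F K L i = Rintegral mu (G : set (matB R n)) (f K L i).
Proof. by rewrite /F /add_kin ffunE. Qed.

Let Gso g : G g -> SO_mem g. Proof. by case: GSO => _ _ _ + _; exact. Qed.
Let GV g : G g -> G (invmx g). Proof. by case: GSO => _ _ + _ _; exact. Qed.
Let GM g h : G g -> G h -> G (g *m h). Proof. by case: GSO => _ + _ _ _; exact. Qed.
Let Gu g : G g -> g \in unitmx. Proof. by move=> /Gso/SO_unitmx. Qed.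

Let body g K L : convex_body K -> convex_body L -> convex_body (msum K (mat_img g L)).
Proof. by move=> bK bL; apply: msum_convex_body => //; exact: mat_img_convex_body. Qed.

(** Joint continuity in bodies and group element: constant sequences of bodies give continuity on
    [G], varying ones feed [Haar_cvg]. *)
Lemma kin_integrand_cvg (Ks Ls : nat -> set (vec R n)) K L (hs : nat -> mat R n) h i :
  (forall k, convex_body (Ks k)) -> (forall k, convex_body (Ls k)) ->
  convex_body K -> convex_body L -> hausdorff_cvg Ks K -> hausdorff_cvg Ls L ->
  (forall k, G (hs k)) -> G h -> hs k @[k --> \oo] --> h ->
  f (Ks k) (Ls k) i (hs k) @[k --> \oo] --> f K L i h.
Proof.
move=> bKs bLs bK bL KsK LsL Ghs Gh hsh.
rewrite /f /bop /tens_op; under eq_fun do rewrite ffunE; rewrite ffunE.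
apply: cvg_sum => j; apply: cvgM.
  apply: cvg_bigprod => k; case: ifP => _; first exact: cvg_cst.
  exact: (cvg_comp _ _ hsh (@coord_continuous _ _ _ _ _ h)).
have [_ _ Phic _] := PhiG.1.
apply: (Phic (fun k => msum (Ks k) (mat_img (invmx (hs k)) (Ls k)))) => [k||].
- exact: body.
- exact: body.
apply: hausdorff_cvg_msum_img => //; last by case: bL => _ [].
(* On [G] inversion is transposition, hence continuous. *)
- under eq_fun => k do rewrite (SO_inv (Gso (Ghs k))).
  by rewrite (SO_inv (Gso Gh)); exact: cvg_trmx.
- by move=> k; apply: SO_norm_le1; apply: Gso; exact: GV.
Qed.

Lemma kin_integrand_seq_cont K L i :
  convex_body K -> convex_body L -> seq_cont G (f K L i).
Proof.
move=> bK bL x y Gx Gy xy.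
by apply: (@kin_integrand_cvg (fun=> K) (fun=> L)) => //; exact: hausdorff_cvg_cst.
Qed.

Lemma hausdorff_cvg_sub (Ks : nat -> set (vec R n)) K (k : nat -> nat) :
  hausdorff_cvg Ks K -> (forall j, (j <= k j)%N) -> hausdorff_cvg (Ks \o k) K.
Proof.
move=> KsK jk e e0; have [N _ NP] := KsK e e0.
by exists N => // j Nj; apply: NP; exact: leq_trans Nj (jk j).
Qed.

Lemma add_kin_cvg (Ks Ls : nat -> set (vec R n)) K L i :
  (forall k, convex_body (Ks k)) -> (forall k, convex_body (Ls k)) ->
  convex_body K -> convex_body L -> hausdorff_cvg Ks K -> hausdorff_cvg Ls L ->
  F (Ks k) (Ls k) i @[k --> \oo] --> F K L i.
Proof.
move=> bKs bLs bK bL KsK LsL; under eq_fun do rewrite FE; rewrite FE.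
apply: (Haar_cvg GSO muG (fs := fun k => f (Ks k) (Ls k) i)).
- by move=> k; exact: kin_integrand_seq_cont.
- exact: kin_integrand_seq_cont.
move=> x y k Gx Gy xy jk.
apply: (@kin_integrand_cvg (Ks \o k) (Ls \o k)) => //.
- by move=> j; exact: bKs.
- by move=> j; exact: bLs.
- exact: hausdorff_cvg_sub.
- exact: hausdorff_cvg_sub.
Qed.

Lemma bop_add_kin (A B : mat R n) K L i : convex_body K -> convex_body L ->
  bop A B (F K L) i = Rintegral mu (G : set (matB R n))
    (fun h : mat R n => bop A B (bop 1%:M h (Phi (msum K (mat_img (invmx h) L)))) i).
Proof.
move=> bK bL; rewrite [LHS]ffunE.
under eq_bigr => j _ do
  rewrite FE -(HaarZ GSO _ (kin_integrand_seq_cont bK bL)).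
rewrite -(Haar_sum GSO); last first.
  by move=> j; apply: seq_contZ; exact: kin_integrand_seq_cont.
by apply: eq_Rintegral => h _; rewrite [RHS]ffunE.
Qed.

(** Substitute $gh^{-1}$ for $g$ in $F(K,L)$ by right invariance. Then
    $K+hg^{-1}L=h(h^{-1}K+g^{-1}L)$, and equivariance of [Phi] brings out $h\otimes h$, which
    combines with $1\otimes gh^{-1}$ to $h\otimes g$ (tensor powers understood). *)
Lemma add_kin_equivl h K L : G h -> convex_body K -> convex_body L ->
  bop h 1%:M (F (mat_img (invmx h) K) L) = F K L.
Proof.
move=> Gh bK bL; apply/ffunP => i; rewrite bop_add_kin//; last exact: mat_img_convex_body.
rewrite FE -(Haar_mulr GSO muG (GV Gh) (kin_integrand_seq_cont (i := i) bK bL)).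
apply: eq_Rintegral => g; rewrite inE => Gg.
have hu : h \in unitmx by exact: Gu.
rewrite /f bop_comp mulmx1 mul1mx.
have -> : invmx (g *m invmx h) = h *m invmx g.
  rewrite (SO_inv (Gso (GM Gg (GV Gh)))) trmx_mul -(SO_inv (Gso (GV Gh))) invmxK.
  by rewrite -(SO_inv (Gso Gg)).
rewrite -(PhiG.2 h _ Gh (body _ bK bL)) mat_img_msum mat_img_comp mulKmx//.
by rewrite -bop_tpow bop_comp mul1mx mulmxKV.
Qed.

(** As $g^{-1}h^{-1}L=(hg)^{-1}L$, the integrand is that of $F(K,L)$ at $hg$, and left invariance
    applies. *)
Lemma add_kin_equivr h K L : G h -> convex_body K -> convex_body L ->
  bop 1%:M h (F K (mat_img (invmx h) L)) = F K L.
Proof.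
move=> Gh bK bL; apply/ffunP => i; rewrite bop_add_kin//; last exact: mat_img_convex_body.
rewrite FE -(Haar_mull GSO muG Gh (kin_integrand_seq_cont (i := i) bK bL)).
apply: eq_Rintegral => g; rewrite inE => Gg.
rewrite /f bop_comp mulmx1 mat_img_comp; congr (bop _ _ (Phi (msum _ (mat_img _ _))) _).
rewrite (SO_inv (Gso (GM Gh Gg))) trmx_mul.
by rewrite (SO_inv (Gso Gh)) (SO_inv (Gso Gg)).
Qed.

Let add_kin_eq K K' L L' i : (forall h, G h ->
    Phi (msum K (mat_img (invmx h) L)) = Phi (msum K' (mat_img (invmx h) L'))) ->
  F K L i = F K' L' i.
Proof.
move=> e; rewrite !FE; apply: eq_Rintegral => h; rewrite inE => Gh.
by rewrite /f e.
Qed.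

Let add_kin_sum K L K1 L1 K2 L2 K3 L3 : convex_body K1 -> convex_body L1 ->
  convex_body K2 -> convex_body L2 -> convex_body K3 -> convex_body L3 ->
  (forall h, G h -> Phi (msum K3 (mat_img (invmx h) L3)) =
     Phi (msum K1 (mat_img (invmx h) L1)) + Phi (msum K2 (mat_img (invmx h) L2)) -
     Phi (msum K (mat_img (invmx h) L))) ->
  F K3 L3 = F K1 L1 + F K2 L2 - F K L.
Proof.
move=> bK1 bL1 bK2 bL2 bK3 bL3 e; apply/eqP.
(* Solved for [F K L]: in the applications this pair contains an intersection, and its integrand is
   expressed through the three whose continuity is at hand. *)
rewrite eq_sym subr_eq [F K3 L3 + _]addrC -subr_eq eq_sym.
apply/eqP/ffunP => i; rewrite [RHS]ffunE [X in X + _]ffunE [X in _ + X]ffunE.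
have c1 := kin_integrand_seq_cont (i := i) bK1 bL1.
have c2 := kin_integrand_seq_cont (i := i) bK2 bL2.
have c3 := kin_integrand_seq_cont (i := i) bK3 bL3.
rewrite !FE -mulN1r -(HaarZ GSO _ c3) -(HaarD GSO c1 c2).
rewrite -(HaarD GSO (seq_contD c1 c2) (seq_contZ c3)).
apply: eq_Rintegral => h; rewrite inE => Gh; rewrite /f (e h Gh) mulN1r.
rewrite /bop !tens_opD tens_opN -/(bop _ _ _).
rewrite [X in _ - X]ffunE [X in _ - (X + _)]ffunE [X in _ - (_ + X)]ffunE.
by rewrite opprB addrC subrK.
Qed.

(** Adding the fixed body $h^{-1}L$ commutes with translations, unions and, when the union is
    convex, intersections, so the integrand inherits invariance and additivity from [Phi]. *)
Lemma lslice_add_kin_valuation L (j : r2.-tuple 'I_n) : convex_body L ->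
  is_G_valuation G (fun K => lslice (F K L) j).
Proof.
have [[Psym Ptr _ Pval] _] := PhiG.
move=> bL; split; last first.
  move=> h K Gh bK; rewrite tpow_lslice add_kin_equivl//.
split.
- move=> K bK s i; rewrite [LHS]ffunE [RHS]ffunE !FE; apply: eq_Rintegral => h _.
  have := @lslice_bop_sym _ _ _ _ 1%:M h _ j (Psym _ (body (invmx h) bK bL)) s i.
  by rewrite [LHS]ffunE [RHS]ffunE.
- move=> K x bK; apply/ffunP => i; rewrite [LHS]ffunE [RHS]ffunE.
  by apply: add_kin_eq => h Gh; rewrite msum_translatel Ptr//; exact: body.
- move=> Ks K bKs bK KsK i; under eq_fun do rewrite ffunE; rewrite ffunE.
  by apply: (add_kin_cvg (Ls := fun=> L)) => //; exact: hausdorff_cvg_cst.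
move=> K K' bK bK' bKK'; rewrite (@add_kin_sum (K `&` K') L K L K' L)//.
  by apply/ffunP => i; rewrite !ffunE.
move=> h Gh; have bhL := mat_img_convex_body (invmx h) bL.
rewrite msum_setUl Pval -?msum_setUl ?msum_setIl//; try exact: msum_convex_body.
by case: bKK' => _ [].
Qed.

(** The linear image under $h^{-1}$ now comes first: it turns translation by [x] into translation by
    $h^{-1}x$ and preserves intersections by injectivity. *)
Lemma rslice_add_kin_valuation K (i : r1.-tuple 'I_n) : convex_body K ->
  is_G_valuation G (fun L => rslice (F K L) i).
Proof.
have [[Psym Ptr _ Pval] _] := PhiG.
move=> bK; split; last first.
  move=> h L Gh bL; rewrite tpow_rslice add_kin_equivr//.
split.
- move=> L bL s j; rewrite [LHS]ffunE [RHS]ffunE !FE; apply: eq_Rintegral => h _.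
  have := @rslice_bop_sym _ _ _ _ 1%:M h _ i (Psym _ (body (invmx h) bK bL)) s j.
  by rewrite [LHS]ffunE [RHS]ffunE.
- move=> L x bL; apply/ffunP => j; rewrite [LHS]ffunE [RHS]ffunE.
  apply: add_kin_eq => h Gh; rewrite mat_img_translate msumC msum_translatel msumC Ptr//.
  exact: body.
- move=> Ls L bLs bL LsL j; under eq_fun do rewrite ffunE; rewrite ffunE.
  by apply: (add_kin_cvg (Ks := fun=> K)) => //; exact: hausdorff_cvg_cst.
move=> L L' bL bL' bLL'; rewrite (@add_kin_sum K (L `&` L') K L K L')//.
  by apply/ffunP => j; rewrite !ffunE.
move=> h Gh; have bhL := mat_img_convex_body (invmx h) bL.
have bhL' := mat_img_convex_body (invmx h) bL'.
have bhU := mat_img_convex_body (invmx h) bLL'.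
rewrite mat_img_setI; last by apply: Gu; exact: GV.
rewrite mat_img_setU in bhU *; rewrite ![msum K _]msumC.
rewrite msum_setUl Pval -?msum_setUl ?msum_setIl//; try exact: msum_convex_body.
by case: bhU => _ [].
Qed.

End AdditiveKinematic.

(** * Extraction of the coefficients *)

Theorem theorem22 (R : realType) (n : nat) (G : set (mat R n))
  (mu : probability (matB R n) R) (r1 r2 m1 m2 : nat)
  (Phis : 'I_m1 -> set (vec R n) -> tens R n r1)
  (Psis : 'I_m2 -> set (vec R n) -> tens R n r2)
  (Phi : set (vec R n) -> tens R n (r1 + r2)) :
  closed_conn_subgroup_SO G -> transitive_on_sphere G -> haar_prob G mu ->
  is_basis_Val G Phis -> is_basis_Val G Psis ->
  is_G_valuation G Phi ->
  exists c : 'I_m1 -> 'I_m2 -> R,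
    forall K L, convex_body K -> convex_body L ->
      add_kin G mu Phi K L =
      \sum_(i < m1) \sum_(j < m2) c i j *: tprod (Phis i K) (Psis j L).
Proof.
move=> GSO _ muG [_ _ Phis_span] [_ Psis_free Psis_span] PhiG.
pose F := add_kin G mu Phi.
(* Each [Psis b] is read as a scalar function of a pair (body, multi-index), so that independence of
   valuations becomes independence of functions. *)
have [|x [bx Au]] := @dual_points R (set (vec R n) * r2.-tuple 'I_n)%type
  (fun p => convex_body p.1) m2 (fun b p => Psis b p.1 p.2).
  move=> a h; apply: Psis_free => L bL; apply/ffunP => j.
  rewrite ffunE sum_ffunE -[RHS](h (L, j) bL); apply: eq_bigr => b _.
  by rewrite ffunE.
set A := \matrix_(_, _) _ in Au.
have /choice[al alP] (c : 'I_m2) : exists a : 'I_m1 -> R, forall K, convex_body K ->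
    lslice (F K (x c).1) (x c).2 = \sum_(k < m1) a k *: Phis k K.
  by apply: Phis_span; exact: lslice_add_kin_valuation.
(* [al c] expands the slice of [F] at the pair [x c] in the [Phis], and [invmx A] converts values at
   the pairs into coefficients of the [Psis]. Neither involves [K] or [L]. *)
exists (fun k b => \sum_(c < m2) invmx A b c * al c k) => K L bK bL.
apply/ffunP => ij; rewrite -(cat_lrpart ij); set i := lpart ij; set j := rpart ij.
have [a aP] : exists a : 'I_m2 -> R, forall L, convex_body L ->
    rslice (F K L) i = \sum_(b < m2) a b *: Psis b L.
  by apply: Psis_span; exact: rslice_add_kin_valuation.
have FE L' (j' : r2.-tuple 'I_n) : convex_body L' ->
    F K L' [tuple of i ++ j'] = \sum_(b < m2) a b * Psis b L' j'.
  move=> bL'; have /ffunP/(_ j') := aP L' bL'; rewrite ffunE => ->.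
  by rewrite sum_ffunE; apply: eq_bigr => b _; rewrite ffunE.
(* The coefficients [a] depend on [K] and [i]. Evaluating their expansion at the pairs [x c] yields
   a linear system with matrix [A], solved by [invmx A]. *)
have aE b : a b = \sum_(c < m2) invmx A b c * F K (x c).1 [tuple of i ++ (x c).2].
  pose v : 'cV[R]_m2 := \col_b a b.
  have -> : a b = (invmx A *m (A *m v)) b 0 by rewrite mulKmx// mxE.
  rewrite mxE; apply: eq_bigr => c _; rewrite FE ?mxE//; congr (_ * _).
  by apply: eq_bigr => b' _; rewrite !mxE mulrC.
(* The same value is also an entry of the left slice, whose expansion in the [Phis] makes the
   dependence on [K] explicit. *)
have alE c : F K (x c).1 [tuple of i ++ (x c).2] = \sum_(k < m1) al c k * Phis k K i.
  have /ffunP/(_ i) := alP c K bK; rewrite ffunE => ->.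
  by rewrite sum_ffunE; apply: eq_bigr => k _; rewrite ffunE.
rewrite -/F FE// sum_ffunE.
under [RHS]eq_bigr => k _ do rewrite sum_ffunE.
rewrite exchange_big /=; apply: eq_bigr => b _.
have -> : a b = \sum_(k < m1) (\sum_(c < m2) invmx A b c * al c k) * Phis k K i.
  rewrite aE; under [LHS]eq_bigr => c _ do rewrite alE mulr_sumr.
  rewrite exchange_big /=; apply: eq_bigr => k _.
  by rewrite mulr_suml; apply: eq_bigr => c _; rewrite mulrA.
rewrite mulr_suml; apply: eq_bigr => k _.
rewrite ffunE [tprod _ _ _]ffunE -/(lpart _) -/(rpart _) lpart_cat rpart_cat.
by rewrite -mulrA.
Qed.
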